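(* Let $n\ge 2$. The assignment $\sigma_i^{\pm1}\mapsto\sigma_i^{\pm1}$ ($1\le i\le n-1$), $b_1\mapsto p_1$, where $p_1=\sigma_1^2$, defines a homomorphism of monoids from $BB_n$ to $B_n$. This homomorphism is surjective but not injective.
   Context: $B_n$ is the Artin braid group with generators $\sigma_1,\dots,\sigma_{n-1}$ and relations $\sigma_i\sigma_j=\sigma_j\sigma_i$ for $|i-j|>1$ and $\sigma_i\sigma_{i+1}\sigma_i=\sigma_{i+1}\sigma_i\sigma_{i+1}$ for $1\le i\le n-2$. Here the (tight) bonded braid monoid $BB_n$ is taken in its irredundant presentation with one bond generator: it is the monoid generated by $\sigma_1^{\pm1},\dots,\sigma_{n-1}^{\pm1}$ and $b_1$, with relations $\sigma_i\sigma_i^{-1}=\sigma_i^{-1}\sigma_i=1$ and (omitting relations that mention $\sigma_k$ with $k\ge n$): 1) $\sigma_i\sigma_j=\sigma_j\sigma_i$ for $|i-j|>1$; 2) $\sigma_i\sigma_{i+1}\sigma_i=\sigma_{i+1}\sigma_i\sigma_{i+1}$ for $1\le i\le n-2$; 3) $b_1(\sigma_2\sigma_1\sigma_3\sigma_2)^{-1}b_1(\sigma_2\sigma_1\sigma_3\sigma_2)=(\sigma_2\sigma_1\sigma_3\sigma_2)^{-1}b_1(\sigma_2\sigma_1\sigma_3\sigma_2)b_1$; 4) $b_1\sigma_j=\sigma_jb_1$ for $j>2$; 5) $b_1\sigma_1=\sigma_1b_1$; 6) $b_1(\sigma_2\sigma_1)(\sigma_1\sigma_2)=(\sigma_2\sigma_1)(\sigma_1\sigma_2)b_1$.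 *)

(* Defs.v *)
From HB Require Import structures.
From mathcomp Require Import all_boot.
From mathcomp Require Import boolp.

Set Implicit Arguments.
Unset Strict Implicit.
Unset Printing Implicit Defensive.

Local Open Scope quotient_scope.
Local Open Scope group_scope.

(* The congruence on the free monoid of words over X generated by R. *)
Inductive word_cong (X : Type) (R : seq X -> seq X -> Prop) :
    seq X -> seq X -> Prop :=
| wc_rel u v : R u v -> word_cong R u v
| wc_refl u : word_cong R u u
| wc_sym u v : word_cong R u v -> word_cong R v u
| wc_trans u v w : word_cong R u v -> word_cong R v w -> word_cong R u w
| wc_cat u u' v v' :
    word_cong R u u' -> word_cong R v v' -> word_cong R (u ++ v) (u' ++ v').

Section PresentedMonoid.
Variables (X : choiceType) (R : seq X -> seq X -> Prop).

Definition word_congb (u v : seq X) : bool := `[< word_cong R u v >].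

Lemma word_congb_refl : reflexive word_congb.
Proof. by move=> u; apply/asboolP/wc_refl. Qed.

Lemma word_congb_sym : symmetric word_congb.
Proof. by move=> u v; apply/asboolP/asboolP => /wc_sym. Qed.

Lemma word_congb_trans : transitive word_congb.
Proof.
by move=> v u w /asboolP uv /asboolP vw; apply/asboolP; apply: wc_trans uv vw.
Qed.

Canonical word_congb_equiv :=
  EquivRel word_congb word_congb_refl word_congb_sym word_congb_trans.

(* The monoid <X | R>. *)
Definition presented_monoid : Type := {eq_quot word_congb}.

HB.instance Definition _ := Choice.on presented_monoid.
HB.instance Definition _ := EqQuotient.on presented_monoid.

Definition word_class (u : seq X) : presented_monoid := \pi_presented_monoid u.

Lemma word_class_repr (x : presented_monoid) : word_class (repr x) = x.
Proof. exact: reprK. Qed.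

Lemma word_class_eq u v : word_class u = word_class v <-> word_cong R u v.
Proof.
by split=> [/eqP | uv]; [|apply/eqP]; rewrite eqmodE; [move/asboolP|apply/asboolP].
Qed.

Definition pm_one : presented_monoid := word_class [::].
Definition pm_mul := lift_op2 presented_monoid (@cat X).

Lemma pm_mulE u v : pm_mul (word_class u) (word_class v) = word_class (u ++ v).
Proof.
rewrite /pm_mul -lock.
apply/word_class_eq; apply: wc_cat; apply/word_class_eq; exact: word_class_repr.
Qed.

Lemma pm_mulA : associative pm_mul.
Proof.
move=> x y z; rewrite -(word_class_repr x) -(word_class_repr y).
by rewrite -(word_class_repr z) !pm_mulE catA.
Qed.

Lemma pm_1mul : left_id pm_one pm_mul.
Proof. by move=> x; rewrite -(word_class_repr x) pm_mulE. Qed.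

Lemma pm_mul1 : right_id pm_one pm_mul.
Proof. by move=> x; rewrite -(word_class_repr x) pm_mulE cats0. Qed.

HB.instance Definition _ :=
  isMonoid.Build presented_monoid pm_mulA pm_1mul pm_mul1.

Lemma word_classM u v : word_class (u ++ v) = word_class u * word_class v.
Proof. by rewrite -pm_mulE. Qed.

Lemma word_class1 : word_class [::] = 1.
Proof. by []. Qed.

End PresentedMonoid.

(* The letter (x, false) stands for x and (x, true) for its inverse. *)
Definition signed (X : Type) : Type := (X * bool)%type.
HB.instance Definition _ (X : choiceType) :=
  Choice.copy (signed X) (X * bool)%type.

Definition flip (X : Type) (a : signed X) : signed X := (a.1, ~~ a.2).
Definition pos (X : Type) (u : seq X) : seq (signed X) :=
  [seq (x, false) | x <- u].
Definition winv (X : Type) (u : seq (signed X)) : seq (signed X) :=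
  rev (map (@flip X) u).

Inductive group_rel (X : Type) (R : seq (signed X) -> seq (signed X) -> Prop) :
    seq (signed X) -> seq (signed X) -> Prop :=
| group_rel_inv a : group_rel R [:: a; flip a] [::]
| group_rel_of u v : R u v -> group_rel R u v.

Section PresentedGroup.
Variables (X : choiceType) (R : seq (signed X) -> seq (signed X) -> Prop).

(* The group <X | R>. *)
Definition presented_group : Type := presented_monoid (group_rel R).

HB.instance Definition _ := Monoid.on presented_group.

Definition group_class (u : seq (signed X)) : presented_group :=
  word_class (group_rel R) u.

Lemma flipK : involutive (@flip X).
Proof. by case=> x b; rewrite /flip /= negbK. Qed.

Lemma winvK : involutive (@winv X).
Proof.
move=> u; rewrite /winv map_rev revK -map_comp map_id_in // => a _.
exact: flipK.
Qed.

Lemma winv_cons a (u : seq (signed X)) : winv (a :: u) = winv u ++ [:: flip a].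
Proof. by rewrite /winv /= rev_cons cats1. Qed.

Lemma winv_cat (u v : seq (signed X)) : winv (u ++ v) = winv v ++ winv u.
Proof. by rewrite /winv map_cat rev_cat. Qed.

Lemma wc_mulV u : word_cong (group_rel R) (u ++ winv u) [::].
Proof.
elim: u => [|a u IH]; first exact: wc_refl.
rewrite winv_cons -cat1s -catA (catA u).
apply: wc_trans (wc_rel (group_rel_inv R a)).
apply: (@wc_cat _ _ [:: a] [:: a] _ [:: flip a]); first exact: wc_refl.
rewrite -[X in word_cong _ _ X]cat0s.
by apply: wc_cat => //; exact: wc_refl.
Qed.

Lemma wc_winv u v :
  word_cong (group_rel R) u v -> word_cong (group_rel R) (winv u) (winv v).
Proof.
move=> uv.
have Vv : word_cong (group_rel R) (winv u ++ u) [::].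
  by rewrite -{2}[u]winvK; exact: wc_mulV.
have e : word_cong (group_rel R) (winv u ++ (v ++ winv v)) (winv u).
  rewrite -[X in word_cong _ _ X]cats0.
  by apply: wc_cat; [exact: wc_refl | exact: wc_mulV].
apply: wc_trans (wc_sym e) _; rewrite catA -[X in word_cong _ _ X]cat0s.
apply: wc_cat; last exact: wc_refl.
apply: wc_trans Vv; apply: wc_cat; [exact: wc_refl | exact: wc_sym].
Qed.

Definition pg_inv := lift_op1 presented_group (@winv X).

Lemma pg_invE u : pg_inv (group_class u) = group_class (winv u).
Proof.
rewrite /pg_inv -lock.
apply/word_class_eq; apply: wc_winv; apply/word_class_eq; exact: word_class_repr.
Qed.

HB.instance Definition _ := hasInv.Build presented_group pg_inv.

Lemma pg_mulV : right_inverse 1 pg_inv (@mul presented_group).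
Proof.
move=> x; rewrite -(word_class_repr x) [pg_inv _]pg_invE -[LHS]word_classM.
by apply/word_class_eq; exact: wc_mulV.
Qed.

Lemma pg_Vmul : left_inverse 1 pg_inv (@mul presented_group).
Proof.
move=> x; rewrite -(word_class_repr x) [pg_inv _]pg_invE -[LHS]word_classM.
by apply/word_class_eq; rewrite -{2}[repr x]winvK; exact: wc_mulV.
Qed.

HB.instance Definition _ := Monoid_isGroup.Build presented_group pg_Vmul pg_mulV.

Lemma group_classM u v : group_class (u ++ v) = group_class u * group_class v.
Proof. exact: word_classM. Qed.

Lemma group_classV u : group_class (winv u) = (group_class u)^-1.
Proof. by rewrite -pg_invE. Qed.

End PresentedGroup.

(* The index set {1, ..., n-1} of the generators. *)
Definition gen_index (n : nat) : Type := {i : nat | (0 < i < n)%N}.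
HB.instance Definition _ n :=
  Choice.copy (gen_index n) {i : nat | (0 < i < n)%N}.

Inductive braid_rel (n : nat) :
    seq (signed (gen_index n)) -> seq (signed (gen_index n)) -> Prop :=
| braid_comm (i j : gen_index n) :
    ((val i).+1 < val j)%N || ((val j).+1 < val i)%N ->
    braid_rel (pos [:: i; j]) (pos [:: j; i])
| braid_yb (i j : gen_index n) :
    val j = (val i).+1 ->
    braid_rel (pos [:: i; j; i]) (pos [:: j; i; j]).

Definition braid_group (n : nat) : Type := presented_group (@braid_rel n).
HB.instance Definition _ n := Group.on (braid_group n).

Definition sigma (n : nat) (i : gen_index n) : braid_group n :=
  group_class (@braid_rel n) (pos [:: i]).

(* In words over option (signed (gen_index n)), the letter None is the bond b_1;
   Some (i, false) is sigma_i and Some (i, true) is its formal inverse. *)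
Definition bond {n : nat} : seq (option (signed (gen_index n))) := [:: None].
Definition braidw (n : nat) (u : seq (signed (gen_index n))) :
    seq (option (signed (gen_index n))) := map some u.

(* bonded_braid gives the inverse laws and the braid relations.  The other
   relations hold whenever indices with the stated values exist, so those that
   mention a sigma_k with k >= n are omitted. *)
Inductive bonded_rel (n : nat) :
    seq (option (signed (gen_index n))) ->
    seq (option (signed (gen_index n))) -> Prop :=
| bonded_braid u v :
    group_rel (@braid_rel n) u v -> bonded_rel (braidw u) (braidw v)
| bonded_bond (s1 s2 s3 : gen_index n) :
    val s1 = 1%N -> val s2 = 2%N -> val s3 = 3%N ->
    let w := pos [:: s2; s1; s3; s2] in
    bonded_rel (bond ++ braidw (winv w) ++ bond ++ braidw w)
               (braidw (winv w) ++ bond ++ braidw w ++ bond)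
| bonded_far (j : gen_index n) :
    (2 < val j)%N ->
    bonded_rel (bond ++ braidw (pos [:: j])) (braidw (pos [:: j]) ++ bond)
| bonded_one (s1 : gen_index n) :
    val s1 = 1%N ->
    bonded_rel (bond ++ braidw (pos [:: s1])) (braidw (pos [:: s1]) ++ bond)
| bonded_two (s1 s2 : gen_index n) :
    val s1 = 1%N -> val s2 = 2%N ->
    let w := pos [:: s2; s1; s1; s2] in
    bonded_rel (bond ++ braidw w) (braidw w ++ bond).

Definition bonded_monoid (n : nat) : Type := presented_monoid (@bonded_rel n).
HB.instance Definition _ n := Monoid.on (bonded_monoid n).

Definition bsigma (n : nat) (i : gen_index n) : bonded_monoid n :=
  word_class (@bonded_rel n) [:: Some (i, false)].
Definition bsigmaV (n : nat) (i : gen_index n) : bonded_monoid n :=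
  word_class (@bonded_rel n) [:: Some (i, true)].
Definition b1 (n : nat) : bonded_monoid n := word_class (@bonded_rel n) bond.

Definition gen_index1 (n : nat) (hn : (2 <= n)%N) : gen_index n :=
  exist (fun i : nat => (0 < i < n)%N) 1%N hn.

Definition p1 (n : nat) (hn : (2 <= n)%N) : braid_group n :=
  sigma (gen_index1 hn) ^+ 2.

Definition assigns (n : nat) (hn : (2 <= n)%N)
    (f : bonded_monoid n -> braid_group n) : Prop :=
  [/\ forall i : gen_index n, f (bsigma i) = sigma i,
      forall i : gen_index n, f (bsigmaV i) = (sigma i)^-1
    & f (b1 n) = p1 hn].

(* Main.v *)
(* In B_n put p = sigma_1^2.  Relations 4) and 5) for p are immediate, 6) holds
   because sigma_1 commutes with sigma_2 sigma_1^2 sigma_2, and 3) because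
   conjugation by w = sigma_2 sigma_1 sigma_3 sigma_2 sends sigma_1 to sigma_3.
   Injectivity fails on the pair b_1, sigma_1^2: both sides of every relation of
   BB_n contain the same number of bonds, so these two elements differ. *)
From HB Require Import structures.
Require Import Defs.
From mathcomp Require Import all_boot.

Set Implicit Arguments.
Unset Strict Implicit.
Unset Printing Implicit Defensive.

Local Open Scope group_scope.

Section UniversalProperty.
Variables (X : choiceType) (R : seq X -> seq X -> Prop) (G : monoidType).

Definition word_eval (phi : X -> G) (u : seq X) : G :=
  \big[*%g/1]_(x <- u) phi x.

Lemma word_eval_cat phi u v :
  word_eval phi (u ++ v) = word_eval phi u * word_eval phi v.
Proof. exact: big_cat. Qed.

Lemma word_eval_cong phi :
  (forall u v, R u v -> word_eval phi u = word_eval phi v) ->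
  forall u v, word_cong R u v -> word_eval phi u = word_eval phi v.
Proof.
move=> phiR u v; elim=> {u v} //; first by move=> u v w _ -> _ ->.
by move=> u u' v v' _ eu _ ev; rewrite !word_eval_cat eu ev.
Qed.

(** Gives uniqueness: a morphism out of a presented monoid is determined by its values on
    letters. *)
Lemma morph_word_class (g : UMagmaMorphism.type (presented_monoid R) G) u :
  g (word_class R u) = word_eval (fun x => g (word_class R [:: x])) u.
Proof.
elim: u => [|x u IH]; first by rewrite /word_eval big_nil; exact: gmulf1.
by rewrite -cat1s word_classM gmulfM IH /word_eval /= big_cons.
Qed.

Variables (phi : X -> G)
  (phiR : forall u v, R u v -> word_eval phi u = word_eval phi v).

Definition pm_lift (x : presented_monoid R) : G := word_eval phi (repr x).

(** The representative chosen by [repr] is congruent to [u], and [phiR] makes evaluation constant on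
    congruence classes. *)
Lemma pm_liftE u : pm_lift (word_class R u) = word_eval phi u.
Proof.
apply: (word_eval_cong phiR); apply/word_class_eq; exact: word_class_repr.
Qed.

Lemma pm_lift_morphism : monoid_morphism pm_lift.
Proof.
split=> [|x y]; first by rewrite -[1]/(word_class R [::]) pm_liftE /word_eval big_nil.
rewrite -(word_class_repr x) -(word_class_repr y) -word_classM !pm_liftE.
exact: word_eval_cat.
Qed.

Lemma presented_monoid_lift :
  exists f : UMagmaMorphism.type (presented_monoid R) G,
    forall u, f (word_class R u) = word_eval phi u.
Proof.
pose M := isUMagmaMorphism.Build _ _ pm_lift pm_lift_morphism.
pose f : UMagmaMorphism.type (presented_monoid R) G := HB.pack pm_lift M.
by exists f => u; exact: pm_liftE.
Qed.

End UniversalProperty.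

Section BraidIdentities.
Variables (G : groupType) (a b c : G).
Hypothesis ab : a * b * a = b * a * b.

(** Using [ab] twice: (aba)ab = (bab)ab = ba(bab) = ba(aba). This yields relation 6). *)
Lemma braid_commute_full : commute a (b * a * a * b).
Proof. by rewrite /commute !mulgA ab -2!(mulgA (b * a)) -ab !mulgA. Qed.

(** With w = bacb, the claim amounts to aw = wc, and (aba)cb = (bab)cb = ba(bcb) = ba(cbc) = wc. *)
Lemma braid_conjg_shift :
  b * c * b = c * b * c -> commute a c -> a ^ (b * a * c * b) = c.
Proof.
move=> bc ac; apply: (mulgI (b * a * c * b)); rewrite -conjgC.
rewrite !mulgA ab -[RHS]mulgA -[LHS]mulgA -!(mulgA (b * a)) (mulgA b) bc.
by rewrite !mulgA.
Qed.

End BraidIdentities.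

Section SquareOfSigma1.
Variables (n : nat) (hn : (2 <= n)%N).
Let B := braid_group n.
Let cls := group_class (@braid_rel n).

Lemma group_class1 (a : signed (gen_index n)) :
  cls [:: a] = if a.2 then (sigma a.1)^-1 else sigma a.1.
Proof. by case: a => i [] //=; rewrite /sigma -group_classV. Qed.

Lemma sigma_comm (i j : gen_index n) :
  ((val i).+1 < val j)%N -> commute (sigma i) (sigma j).
Proof.
move=> ij; rewrite /commute -!group_classM; apply/word_class_eq/wc_rel.
by apply: group_rel_of; apply: braid_comm; rewrite ij.
Qed.

Lemma sigma_yb (i j : gen_index n) : val j = (val i).+1 ->
  sigma i * sigma j * sigma i = sigma j * sigma i * sigma j.
Proof.
move=> ij; rewrite -!group_classM; apply/word_class_eq/wc_rel.
exact/group_rel_of/braid_yb.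
Qed.

Definition bond_val (x : option (signed (gen_index n))) : B :=
  if x is Some a then cls [:: a] else p1 hn.

Lemma bond_val_braidw u : word_eval bond_val (braidw u) = cls u.
Proof.
rewrite /word_eval /braidw big_map; elim: u => [|a u IH]; first by rewrite big_nil.
by rewrite big_cons IH -group_classM.
Qed.

Lemma bond_val_bond : word_eval bond_val bond = p1 hn.
Proof. exact: big_seq1. Qed.

(** The relations of [bonded_rel] speak of any index of value 1, whereas [p1] uses [gen_index1 hn];
    the two indices coincide because [val] is injective. *)
Lemma p1E (s1 : gen_index n) : val s1 = 1%N -> p1 hn = sigma s1 ^+ 2.
Proof. by move=> s1E; congr (sigma _ ^+ 2); exact: val_inj. Qed.

Lemma bond_val_rel u v :
  bonded_rel u v -> word_eval bond_val u = word_eval bond_val v.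
Proof.
(* Collected in [posS], these rules expand the class of a positive word into a product of
   generators. *)
have pos1 i s : cls (pos (i :: s)) = sigma i * cls (pos s).
  by rewrite -group_classM.
have pos0 : cls (pos [::]) = 1 by [].
have posS := (pos1, pos0, @mulg1 B).
case=> {u v}.
- by move=> u v uv; rewrite !bond_val_braidw; apply/word_class_eq/wc_rel.
- move=> s1 s2 s3 v1 v2 v3 w; rewrite !word_eval_cat !bond_val_braidw bond_val_bond.
  move: (p1 hn) (p1E v1) => p pE.
  rewrite /cls group_classV -/cls /w !posS !mulgA; set W := sigma s2 * _ * _ * _.
  have ac : commute (sigma s1) (sigma s3) by apply: sigma_comm; rewrite v1 v3.
  have WE : sigma s1 ^ W = sigma s3.
    by apply: braid_conjg_shift => //; apply: sigma_yb; rewrite ?v1 ?v2 ?v3.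
  (* Relation 3) says that [p] commutes with its conjugate by [W], which is the square of
     [sigma s3]. *)
  have : commute p (p ^ W).
    by rewrite pE conjXg WE; exact: commuteX2.
  by rewrite /commute conjgE !mulgA.
- move=> j j2; rewrite !word_eval_cat !bond_val_braidw bond_val_bond !posS.
  (* Since [p1] is built on index 1, [2 < val j] is the distance condition of [sigma_comm]. *)
  by apply/commute_sym/commuteX/commute_sym/sigma_comm.
- move=> s1 v1; rewrite !word_eval_cat !bond_val_braidw bond_val_bond !posS.
  by rewrite (p1E v1); apply/commute_sym/commuteX.
- move=> s1 s2 v1 v2 w; rewrite !word_eval_cat !bond_val_braidw bond_val_bond.
  have -> : cls w = sigma s2 * sigma s1 * sigma s1 * sigma s2.
    by rewrite !posS !mulgA.
  rewrite (p1E v1); apply/commute_sym/commuteX/commute_sym.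
  by apply/braid_commute_full/sigma_yb; rewrite v1 v2.
Qed.

End SquareOfSigma1.

(** Counting bonds is additive under concatenation, and each relation has 0, 1 or 2 bonds on both
    sides alike. *)
Lemma count_bond_cong n u v :
  word_cong (@bonded_rel n) u v -> count (pred1 None) u = count (pred1 None) v.
Proof.
have braidw0 w : count (pred1 None) (@braidw n w) = 0%N.
  by rewrite count_map -(count_pred0 w); apply: eq_count.
elim=> {u v} //; first last.
- by move=> u u' v v' _ eu _ ev; rewrite !count_cat eu ev.
- by move=> u v w _ -> _ ->.
move=> u v; case=> *; rewrite ?count_cat ?braidw0 //=.
Qed.

Theorem theorem7p3 (n : nat) (hn : (2 <= n)%N) :
  exists f : UMagmaMorphism.type (bonded_monoid n) (braid_group n),
    [/\ assigns hn f,
        forall g : UMagmaMorphism.type (bonded_monoid n) (braid_group n),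
          assigns hn g -> g =1 f,
        forall y : braid_group n, exists x : bonded_monoid n, f x = y
      & ~ injective f].
Proof.
have [f fE] := presented_monoid_lift (@bond_val_rel n hn).
have fA : assigns hn f.
  by split=> [i|i|]; rewrite fE /word_eval big_seq1 //= group_class1.
exists f; split=> //.
- move=> g [gs gV gb] x; rewrite -(word_class_repr x).
  rewrite (morph_word_class g) fE; apply: eq_bigr => -[[i []]|] _ /=.
  + by rewrite group_class1; exact: gV.
  + exact: gs.
  + exact: gb.
(* A braid word for [y], read as a word without bonds, is a preimage. *)
- move=> y; exists (word_class (@bonded_rel n) (braidw (repr y))).
  by rewrite fE bond_val_braidw; exact: word_class_repr.
- move=> f_inj; have [fs _ fb] := fA.
  have : b1 n = bsigma (gen_index1 hn) * bsigma (gen_index1 hn).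
    by apply: f_inj; rewrite gmulfM fs fb.
  (* The bond counts would be 1 and 0. *)
  by rewrite -word_classM => /word_class_eq /count_bond_cong.
Qed.
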